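(* Let $0<\sigma\le1$ and let $F(a,b)=\operatorname{sgn}(\sigma)\operatorname{tr}A^{\sigma}=a^\sigma+b^\sigma$ for $a,b>0$. Then there exists no maximum-principle function (MPF) for the normal velocity $F$.
   Context: Notation: $\mathbb{R}^2_+=(0,\infty)^2$; subscripts $a,b$ denote partial derivatives. Normal velocity: a symmetric function $F\in C^2(\mathbb{R}^2_+)$, homogeneous of some degree $\sigma\in\mathbb{R}\setminus\{0\}$, with $F_a,F_b>0$ for all $a,b>0$. It is contracting if $F>0$ everywhere on $\mathbb{R}^2_+$ and expanding if $F<0$ everywhere on $\mathbb{R}^2_+$. Maximum-principle function (MPF) for a normal velocity $F$: a symmetric function $w\in C^2(\mathbb{R}^2_+)$, homogeneous of some degree $\chi\in\mathbb{R}\setminus\{0\}$, such that, with $\alpha=-w_a/w_b$ and $\alpha_a=\partial\alpha/\partial a$ (defined for $a\ne b$): (1) $w>0$ whenever $a\neq b$, and $w=0$ whenever $a=b$. (2) $\chi>0$ if $F$ is contracting, $\chi<0$ if $F$ is expanding. (3) $w_a<0$ for all $0<a<b$, and $w_a>0$ for all $0<b<a$. (4) For all $a,b>0$ (for $E_w,G_w$: $a\neq b$) one has $C_w(a,b)\le0$, $E_w(a,b)\le0$, $G_w(a,b)\le 0$, where $$C_w=w_a\,a\big((F_aa^2+F_bb^2)+(F-F_aa-F_bb)a\big)+w_b\,b\big((F_aa^2+F_bb^2)+(F-F_aa-F_bb)b\big),$$ $$E_w=w_a(F_{aa}+2F_{ab}\alpha+F_{bb}\alpha^2)-F_a(w_{aa}+2w_{ab}\alpha+w_{bb}\alpha^2)+2\,\frac{w_bF_a-w_aF_b}{a-b}\,\alpha^2,$$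 $$G_w=\frac1{\alpha^2}\Big(w_b(F_{aa}+2F_{ab}\alpha+F_{bb}\alpha^2)-F_b(w_{aa}+2w_{ab}\alpha+w_{bb}\alpha^2)+2\,\frac{w_bF_a-w_aF_b}{a-b}\Big).$$ (5) There are constants $c>0$, $d\in\mathbb{R}$ such that, evaluating $\alpha$ and $\alpha_a$ at $(a,b)=(\rho,1)$ with $0<\rho<1$: if $F$ is contracting, then either $\alpha=c$ and $\alpha_a=0$ for all sufficiently small $\rho$, or, as $\rho\to0$, $\alpha=\frac c\rho+o(\rho^{-1})$ and $\alpha_a=-\frac c{\rho^2}+o(\rho^{-1})$; if $F$ is expanding, then, as $\rho\to0$, either $\alpha=\frac c\rho+o(\rho^{-1})$ and $\alpha_a=-\frac c{\rho^2}+o(\rho^{-1})$, or $\alpha=\frac{c+d\rho}{\rho^2}+o(\rho^{-1})$ and $\alpha_a=-\frac{2c+d\rho}{\rho^3}+o(\rho^{-1})$. *)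

(* Defs.v *)
From Stdlib Require Import Reals Lra.
From Coquelicot Require Import Coquelicot.
Local Open Scope R_scope.

(** A function on the open quadrant (0,oo)^2 is encoded as a total function
    R -> R -> R of which only the values at positive arguments matter: every
    condition below is restricted to a, b > 0, and derivatives at such points
    depend only on the values on the quadrant. *)

(** Partial derivatives.  Thus [Da (Da f)], [Db (Da f)], [Db (Db f)] are
    f_aa, f_ab, f_bb. *)
Definition Da (f : R -> R -> R) (a b : R) : R := Derive (fun x => f x b) a.
Definition Db (f : R -> R -> R) (a b : R) : R := Derive (fun y => f a y) b.

Definition C1_quadrant (f : R -> R -> R) : Prop :=
  forall a b, 0 < a -> 0 < b ->
    ex_derive (fun x => f x b) a /\
    ex_derive (fun y => f a y) b /\
    continuity_2d_pt (Da f) a b /\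
    continuity_2d_pt (Db f) a b.

Definition C2_quadrant (f : R -> R -> R) : Prop :=
  C1_quadrant f /\ C1_quadrant (Da f) /\ C1_quadrant (Db f).

Definition symmetric_quadrant (f : R -> R -> R) : Prop :=
  forall a b, 0 < a -> 0 < b -> f a b = f b a.

Definition homogeneous_quadrant (f : R -> R -> R) (deg : R) : Prop :=
  forall t a b, 0 < t -> 0 < a -> 0 < b ->
    f (t * a) (t * b) = Rpower t deg * f a b.

Record normal_velocity : Type := NormalVelocity {
  velocity :> R -> R -> R;
  velocity_C2 : C2_quadrant velocity;
  velocity_sym : symmetric_quadrant velocity;
  velocity_homog : exists sigma, sigma <> 0 /\ homogeneous_quadrant velocity sigma;
  velocity_Da_pos : forall a b, 0 < a -> 0 < b -> 0 < Da velocity a b;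
  velocity_Db_pos : forall a b, 0 < a -> 0 < b -> 0 < Db velocity a b
}.

Definition contracting (F : normal_velocity) : Prop :=
  forall a b, 0 < a -> 0 < b -> 0 < F a b.

Definition expanding (F : normal_velocity) : Prop :=
  forall a b, 0 < a -> 0 < b -> F a b < 0.

Definition alpha (w : R -> R -> R) (a b : R) : R := - Da w a b / Db w a b.

Definition C_term (F w : R -> R -> R) (a b : R) : R :=
  let P := Da F a b * a ^ 2 + Db F a b * b ^ 2 in
  let Q := F a b - Da F a b * a - Db F a b * b in
  Da w a b * a * (P + Q * a) + Db w a b * b * (P + Q * b).

(** f_aa + 2 f_ab alpha + f_bb alpha^2. *)
Definition hess_alpha (w f : R -> R -> R) (a b : R) : R :=
  Da (Da f) a b + 2 * Db (Da f) a b * alpha w a b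
  + Db (Db f) a b * alpha w a b ^ 2.

Definition E_term (F w : R -> R -> R) (a b : R) : R :=
  Da w a b * hess_alpha w F a b - Da F a b * hess_alpha w w a b
  + 2 * ((Db w a b * Da F a b - Da w a b * Db F a b) / (a - b))
      * alpha w a b ^ 2.

Definition G_term (F w : R -> R -> R) (a b : R) : R :=
  / alpha w a b ^ 2 *
  (Db w a b * hess_alpha w F a b - Db F a b * hess_alpha w w a b
   + 2 * ((Db w a b * Da F a b - Da w a b * Db F a b) / (a - b))).

(** [asymp f g]: f(rho) = g(rho) + o(1/rho) as rho -> 0, rho > 0. *)
Definition asymp (f g : R -> R) : Prop :=
  is_domin (at_right 0) (fun rho => / rho) (fun rho => f rho - g rho).

(** The three admissible behaviours of alpha(rho, 1) and alpha_a(rho, 1) as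
    rho decreases to 0. *)
Definition alpha_const (w : R -> R -> R) (c : R) : Prop :=
  at_right 0 (fun rho => alpha w rho 1 = c /\ Da (alpha w) rho 1 = 0).

Definition alpha_order1 (w : R -> R -> R) (c : R) : Prop :=
  asymp (fun rho => alpha w rho 1) (fun rho => c / rho) /\
  asymp (fun rho => Da (alpha w) rho 1) (fun rho => - (c / rho ^ 2)).

Definition alpha_order2 (w : R -> R -> R) (c d : R) : Prop :=
  asymp (fun rho => alpha w rho 1) (fun rho => (c + d * rho) / rho ^ 2) /\
  asymp (fun rho => Da (alpha w) rho 1)
        (fun rho => - ((2 * c + d * rho) / rho ^ 3)).

Record MPF (F : normal_velocity) (w : R -> R -> R) : Prop := {
  mpf_C2 : C2_quadrant w;
  mpf_sym : symmetric_quadrant w;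
  mpf_pos : forall a b, 0 < a -> 0 < b -> a <> b -> 0 < w a b;
  mpf_diag : forall a, 0 < a -> w a a = 0;
  mpf_homog : exists chi, chi <> 0 /\ homogeneous_quadrant w chi /\
    (contracting F -> 0 < chi) /\ (expanding F -> chi < 0);
  mpf_Da_neg : forall a b, 0 < a -> a < b -> Da w a b < 0;
  mpf_Da_pos : forall a b, 0 < b -> b < a -> 0 < Da w a b;
  mpf_C : forall a b, 0 < a -> 0 < b -> C_term F w a b <= 0;
  mpf_E : forall a b, 0 < a -> 0 < b -> a <> b -> E_term F w a b <= 0;
  mpf_G : forall a b, 0 < a -> 0 < b -> a <> b -> G_term F w a b <= 0;
  mpf_asymp : exists c d, 0 < c /\
    (contracting F -> alpha_const w c \/ alpha_order1 w c) /\
    (expanding F -> alpha_order1 w c \/ alpha_order2 w c d)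
}.

Lemma locally_pos (x : R) : 0 < x -> locally x (fun t => 0 < t).
Proof. intro H. exact (open_gt 0 x H). Qed.

Lemma C1_quadrant_sum (f : R -> R -> R) (h k h' k' : R -> R) :
  (forall a b, 0 < a -> 0 < b -> f a b = h a + k b) ->
  (forall x, 0 < x -> is_derive h x (h' x)) ->
  (forall x, 0 < x -> is_derive k x (k' x)) ->
  (forall x, 0 < x -> continuity_pt h' x) ->
  (forall x, 0 < x -> continuity_pt k' x) ->
  C1_quadrant f /\
  (forall a b, 0 < a -> 0 < b -> Da f a b = h' a) /\
  (forall a b, 0 < a -> 0 < b -> Db f a b = k' b).
Proof.
intros Hf Hh Hk Ch Ck.
assert (DA : forall a b, 0 < a -> 0 < b -> is_derive (fun x => f x b) a (h' a)).
{ intros a b Ha Hb.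
  apply is_derive_ext_loc with (fun x => h x + k b).
  - apply filter_imp with (2 := locally_pos a Ha).
    intros t Ht; symmetry; now apply Hf.
  - replace (h' a) with (h' a + 0) by ring.
    apply (is_derive_plus h (fun _ => k b) a (h' a) 0).
    + now apply Hh.
    + exact (is_derive_const (k b) a). }
assert (DB : forall a b, 0 < a -> 0 < b -> is_derive (fun y => f a y) b (k' b)).
{ intros a b Ha Hb.
  apply is_derive_ext_loc with (fun y => h a + k y).
  - apply filter_imp with (2 := locally_pos b Hb).
    intros t Ht; symmetry; now apply Hf.
  - replace (k' b) with (0 + k' b) by ring.
    apply (is_derive_plus (fun _ => h a) k b 0 (k' b)).
    + exact (is_derive_const (h a) b).
    + now apply Hk. }
assert (EA : forall a b, 0 < a -> 0 < b -> Da f a b = h' a).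
{ intros a b Ha Hb; apply is_derive_unique; now apply DA. }
assert (EB : forall a b, 0 < a -> 0 < b -> Db f a b = k' b).
{ intros a b Ha Hb; apply is_derive_unique; now apply DB. }
split; [| now split].
assert (L : forall (P : R -> R -> Prop) a b, 0 < a -> 0 < b ->
          (forall u v, 0 < u -> 0 < v -> P u v) -> locally_2d P a b).
{ intros P a b Ha Hb HP.
  destruct (locally_pos a Ha) as [da Hda].
  destruct (locally_pos b Hb) as [db Hdb].
  assert (Hm : 0 < Rmin da db) by (apply Rmin_pos; [apply da | apply db]).
  exists (mkposreal _ Hm); simpl; intros u v Hu Hv.
  apply HP.
  - apply Hda. apply Rlt_le_trans with (1 := Hu), Rmin_l.
  - apply Hdb. apply Rlt_le_trans with (1 := Hv), Rmin_r. }
intros a b Ha Hb; repeat split.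
- eexists; now apply DA.
- eexists; now apply DB.
- apply continuity_2d_pt_ext_loc with (fun u _ => h' u).
  + apply L; trivial; intros; symmetry; now apply EA.
  + apply (continuity_1d_2d_pt_comp h' (fun u _ => u)); [now apply Ch |].
    apply continuity_2d_pt_id1.
- apply continuity_2d_pt_ext_loc with (fun _ v => k' v).
  + apply L; trivial; intros; symmetry; now apply EB.
  + apply (continuity_1d_2d_pt_comp k' (fun _ v => v)); [now apply Ck |].
    apply continuity_2d_pt_id2.
Qed.

(** The functions a^sigma + b^sigma, sigma > 0, are normal velocities. *)
Lemma trace_power_normal_velocity (sigma : R) : 0 < sigma ->
  exists F : normal_velocity, forall a b, 0 < a -> 0 < b ->
    F a b = Rpower a sigma + Rpower b sigma.
Proof.
intro Hs.
assert (D : forall s x, 0 < x ->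
  is_derive (fun t => Rpower t s) x (s * Rpower x (s - 1))).
{ intros s x Hx; apply is_derive_Reals; now apply derivable_pt_lim_power. }
assert (D1 : forall c s x, 0 < x ->
  is_derive (fun t => c * Rpower t s) x (c * (s * Rpower x (s - 1)))).
{ intros c s x Hx.
  apply (is_derive_scal (fun t => Rpower t s) x c); now apply D. }
assert (K : forall c s x, 0 < x -> continuity_pt (fun t => c * Rpower t s) x).
{ intros c s x Hx; apply continuity_pt_filterlim.
  apply (ex_derive_continuous (fun t => c * Rpower t s) x).
  eexists; now apply D1. }
assert (K2 : forall c d s x, 0 < x ->
  continuity_pt (fun t => c * (d * Rpower t s)) x).
{ intros c d s x Hx.
  apply continuity_pt_ext with (fun t => (c * d) * Rpower t s).
  - intro t; ring.
  - now apply K. }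
assert (Z : forall x, 0 < x -> is_derive (fun _ : R => 0) x ((fun _ => 0) x)).
{ intros x _; exact (is_derive_const 0 x). }
assert (Kz : forall x, 0 < x -> continuity_pt (fun _ => 0) x).
{ intros x _; now apply continuity_pt_const. }
set (f := fun a b => Rpower a sigma + Rpower b sigma).
set (g := fun t => sigma * Rpower t (sigma - 1)).
set (g' := fun t => sigma * ((sigma - 1) * Rpower t (sigma - 1 - 1))).
destruct (C1_quadrant_sum f (fun t => Rpower t sigma) (fun t => Rpower t sigma)
  g g) as [C [EA EB]]; trivial.
{ intros; now apply D. }
{ intros; now apply D. }
{ intros; now apply K. }
{ intros; now apply K. }
destruct (C1_quadrant_sum (Da f) g (fun _ => 0) g' (fun _ => 0)) as [CA _];
  trivial.
{ intros a b Ha Hb; rewrite EA; trivial; ring. }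
{ intros; now apply D1. }
{ intros; now apply K2. }
destruct (C1_quadrant_sum (Db f) (fun _ => 0) g (fun _ => 0) g') as [CB _];
  trivial.
{ intros a b Ha Hb; rewrite EB; trivial; ring. }
{ intros; now apply D1. }
{ intros; now apply K2. }
assert (Hg : forall t, 0 < g t).
{ intro t; apply Rmult_lt_0_compat; [exact Hs | apply exp_pos]. }
unshelve eexists (NormalVelocity f _ _ _ _ _); trivial.
- now split.
- intros a b _ _; unfold f; ring.
- exists sigma; split; [lra |].
  intros t a b Ht Ha Hb; unfold f.
  rewrite <- !Rpower_mult_distr by assumption; ring.
- intros a b Ha Hb; now rewrite EA.
- intros a b Ha Hb; now rewrite EB.
Qed.

(* Main.v *)
Require Import Defs.
From Stdlib Require Import Reals.
From Coquelicot Require Import Coquelicot.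
From Stdlib Require Import Lra.
Local Open Scope R_scope.

(** Write [C_w = w_a a (P + Q a) + w_b b (P + Q b)].  Here
    [P > 0] because [F_a, F_b > 0], while Euler's relation gives
    [Q = (1 - sigma) F >= 0] and
    [a w_a + b w_b = chi w > 0] for [w] off the diagonal.  Hence for [a < b],
    where [w_b > 0] by symmetry,
    [C_w = chi w (P + Q a) + w_b b Q (b - a) > 0],
    which contradicts condition (4). *)

Lemma euler_homogeneous (f : R -> R -> R) (deg a b : R) :
  homogeneous_quadrant f deg -> 0 < a -> 0 < b ->
  ex_derive (fun x => f x b) a ->
  a * Da f a b + b * Db f a b = deg * f a b.
Proof.
intros Hf Ha Hb Hd.
(* Scaling turns variation of [b] into variation of [a], which avoids the
   two-variable chain rule. *)
assert (D : is_derive (fun y => Rpower (y / b) deg * f (a * b / y) b) b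
              (deg / b * f a b - a / b * Da f a b)).
{ assert (D1 : is_derive (fun y => Rpower (y / b) deg) b (deg / b)).
  { unfold Rpower; auto_derive.
    - replace (b * / b) with 1 by (field; lra); lra.
    - replace (b * / b) with 1 by (field; lra).
      rewrite ln_1, Rmult_0_r, exp_0; field; lra. }
  assert (D2 : is_derive (fun y => f (a * b / y) b) b (- (a / b) * Da f a b)).
  { apply (is_derive_comp (fun x => f x b) (fun y => a * b / y)).
    - replace (a * b / b) with a by (field; lra).
      now apply Derive_correct.
    - auto_derive; [lra | field; lra]. }
  replace (deg / b * f a b - a / b * Da f a b)
    with (deg / b * f (a * b / b) b
          + Rpower (b / b) deg * (- (a / b) * Da f a b)).
  - apply (is_derive_mult (fun y => Rpower (y / b) deg)
             (fun y => f (a * b / y) b)); trivial.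
    exact Rmult_comm.
  - replace (a * b / b) with a by (field; lra).
    replace (b / b) with 1 by (field; lra).
    unfold Rpower; rewrite ln_1, Rmult_0_r, exp_0; field; lra. }
(* Homogeneity with scaling factor [y / b] at the point [(a * b / y, b)] gives [f a y = Rpower (y /
   b) deg * f (a * b / y) b] for [y > 0], so [D] computes [Db f a b]. *)
assert (E : Db f a b = deg / b * f a b - a / b * Da f a b).
{ apply is_derive_unique; revert D; apply is_derive_ext_loc.
  apply filter_imp with (2 := locally_pos b Hb); intros y Hy.
  rewrite <- Hf; trivial.
  - f_equal; field; lra.
  - now apply Rdiv_lt_0_compat.
  - apply Rdiv_lt_0_compat; [now apply Rmult_lt_0_compat | trivial]. }
rewrite E; field; lra.
Qed.

Lemma symmetric_Db (f : R -> R -> R) (a b : R) :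
  symmetric_quadrant f -> 0 < a -> 0 < b -> Db f a b = Da f b a.
Proof.
intros Hf Ha Hb; apply Derive_ext_loc.
apply filter_imp with (2 := locally_pos b Hb); intros y Hy; now apply Hf.
Qed.

(** Degree at most 1 together with [F > 0] forces [Q >= 0], whatever the formula for [F]. The
    inequality [C_w <= 0] then already fails at the single point [(1, 2)]. *)
Lemma no_MPF_degree_le1 (F : normal_velocity) (sigma : R) :
  sigma <= 1 -> homogeneous_quadrant F sigma -> contracting F ->
  ~ exists w : R -> R -> R, MPF F w.
Proof.
intros Hs HF HC [w Hw].
destruct (mpf_homog F w Hw) as [chi [_ [Hh [Hchi _]]]].
specialize (Hchi HC).
assert (EF := euler_homogeneous F sigma 1 2 HF Rlt_0_1 Rlt_0_2
                (proj1 (proj1 (velocity_C2 F) 1 2 Rlt_0_1 Rlt_0_2))).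
assert (Ew := euler_homogeneous w chi 1 2 Hh Rlt_0_1 Rlt_0_2
                (proj1 (proj1 (mpf_C2 F w Hw) 1 2 Rlt_0_1 Rlt_0_2))).
assert (HP : 0 < Da F 1 2 * 1 ^ 2 + Db F 1 2 * 2 ^ 2).
{ assert (HA := velocity_Da_pos F 1 2 Rlt_0_1 Rlt_0_2).
  assert (HB := velocity_Db_pos F 1 2 Rlt_0_1 Rlt_0_2).
  lra. }
assert (HQ : 0 <= F 1 2 - Da F 1 2 * 1 - Db F 1 2 * 2).
{ replace (F 1 2 - Da F 1 2 * 1 - Db F 1 2 * 2)
    with ((1 - sigma) * F 1 2) by lra.
  apply Rmult_le_pos; [lra | apply Rlt_le, HC; lra]. }
(* Symmetry turns [w_b] at [(1, 2)] into [w_a] at [(2, 1)], where the first argument is the larger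
   one. *)
assert (Hwb : 0 < Db w 1 2).
{ rewrite (symmetric_Db w 1 2 (mpf_sym F w Hw) Rlt_0_1 Rlt_0_2).
  apply (mpf_Da_pos F w Hw); lra. }
assert (Hw0 : 0 < chi * w 1 2).
{ apply Rmult_lt_0_compat; trivial; apply (mpf_pos F w Hw); lra. }
assert (HCw := mpf_C F w Hw 1 2 Rlt_0_1 Rlt_0_2).
unfold C_term in HCw; cbv zeta in HCw.
set (P := Da F 1 2 * 1 ^ 2 + Db F 1 2 * 2 ^ 2) in *.
set (Q := F 1 2 - Da F 1 2 * 1 - Db F 1 2 * 2) in *.
(* At [(1, 2)] one has [C_w = (w_a + 2 w_b) (P + Q) + 2 w_b Q], and [Ew] identifies the first factor
   with [chi w]. *)
assert (H1 : 0 < chi * w 1 2 * (P + Q)) by (apply Rmult_lt_0_compat; lra).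
assert (H2 : 0 <= Db w 1 2 * Q) by (apply Rmult_le_pos; lra).
rewrite <- Ew in H1; lra.
Qed.

Theorem theorem10p1 (sigma : R) (sigma_pos : 0 < sigma) (sigma_le1 : sigma <= 1)
    (F : normal_velocity)
    (F_eq : forall a b : R, 0 < a -> 0 < b ->
              F a b = Rpower a sigma + Rpower b sigma) :
  ~ exists w : R -> R -> R, MPF F w.
Proof.
apply (no_MPF_degree_le1 F sigma sigma_le1).
- intros t a b Ht Ha Hb.
  rewrite !F_eq by (trivial; now apply Rmult_lt_0_compat).
  rewrite <- !Rpower_mult_distr by assumption; ring.
- intros a b Ha Hb; rewrite F_eq by trivial.
  (* [Rpower] unfolds to an exponential, hence is positive. *)
  apply Rplus_lt_0_compat; apply exp_pos.
Qed.
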